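(* Let $G=(S, K)$ be a prime split $\{H_1,H_2,\overline{H_1},\overline{H_2}\}$-free graph, where $S$ is a stable set and $K$ is a clique, and let $A_1=\{s\in S : \deg_G(s)=1\}$. Then $$|A_1|+1 \leq \gamma_{\{R2\}} (G) \leq |A_1|+3.$$
   Context: All graphs are finite, undirected and simple. For a graph $G=(V,E)$, a function $f:V\to\{0,1,2\}$ is a Roman $\{2\}$-dominating function of $G$ if for every $v\in V$ with $f(v)=0$, either $v$ has a neighbor $u$ with $f(u)=2$, or $v$ has two distinct neighbors $x,y$ with $f(x)=f(y)=1$. The weight of $f$ is $\sum_{v\in V}f(v)$, and $\gamma_{\{R2\}}(G)$ is the minimum weight of a Roman $\{2\}$-dominating function of $G$. A graph is split if its vertex set is partitioned into a stable set $S$ and a clique $K$; notation $G=(S,K)$. A module of $G$ is a set $M\subseteq V$ such that every vertex of $V\setminus M$ is adjacent either to all vertices of $M$ or to none of them. A graph with at least 2 vertices is prime if its only modules are $\emptyset$, $V$ and the singletons. For a set $\mathcal H$ of graphs, $G$ is $\mathcal H$-free if no induced subgraph of $G$ is isomorphic to a graph in $\mathcal H$. $\overline{F}$ is the complement of $F$. $H_1$ is the graph on vertices $0,\dots,5$ with edges $01,12,23,14,25$; $H_2$ is the graph on vertices $0,\dots,5$ with edges $01,12,23,14,15$. *)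

(* Defs.v *)
From mathcomp Require Import all_boot.

Set Implicit Arguments.
Unset Strict Implicit.
Unset Printing Implicit Defensive.

Record sgraph := SGraph {
  vertex :> finType;
  adj : rel vertex;
  adj_sym : symmetric adj;
  adj_irrefl : irreflexive adj }.

Definition neighbors (G : sgraph) (v : G) : {set G} := [set u | adj v u].
Definition deg (G : sgraph) (v : G) : nat := #|neighbors v|.

Section Complement.
Variable G : sgraph.

Definition compl_adj : rel G := [rel x y | (x != y) && ~~ adj x y].

Lemma compl_adj_sym : symmetric compl_adj.
Proof. by move=> x y; rewrite /compl_adj /= eq_sym adj_sym. Qed.

Lemma compl_adj_irrefl : irreflexive compl_adj.
Proof. by move=> x; rewrite /compl_adj /= eqxx. Qed.

Definition compl : sgraph := SGraph compl_adj_sym compl_adj_irrefl.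
End Complement.

Section Induced.
Variables (G : sgraph) (A : {set G}).

Definition induced_adj : rel {x : G | x \in A} :=
  [rel x y | adj (val x) (val y)].

Lemma induced_adj_sym : symmetric induced_adj.
Proof. by move=> x y; rewrite /induced_adj /= adj_sym. Qed.

Lemma induced_adj_irrefl : irreflexive induced_adj.
Proof. by move=> x; rewrite /induced_adj /= adj_irrefl. Qed.

Definition induced : sgraph := SGraph induced_adj_sym induced_adj_irrefl.
End Induced.

Definition graph_iso (F G : sgraph) : Prop :=
  exists h : F -> G, bijective h /\ forall x y, adj (h x) (h y) = adj x y.

Definition free (Hs : sgraph -> Prop) (G : sgraph) : Prop :=
  forall (F : sgraph) (A : {set G}), Hs F -> ~ graph_iso (induced A) F.

Section EdgeList.
Variables (n : nat) (E : seq (nat * nat)).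

(* The edges in E are unoriented; loops in E are ignored. *)
Definition edges_adj : rel 'I_n :=
  [rel i j | (i != j) &&
     (((val i, val j) \in E) || ((val j, val i) \in E))].

Lemma edges_adj_sym : symmetric edges_adj.
Proof. by move=> i j; rewrite /edges_adj /= eq_sym orbC. Qed.

Lemma edges_adj_irrefl : irreflexive edges_adj.
Proof. by move=> i; rewrite /edges_adj /= eqxx. Qed.

Definition graph_of_edges : sgraph := SGraph edges_adj_sym edges_adj_irrefl.
End EdgeList.

Definition H1 : sgraph :=
  graph_of_edges 6 [:: (0, 1); (1, 2); (2, 3); (1, 4); (2, 5)].
Definition H2 : sgraph :=
  graph_of_edges 6 [:: (0, 1); (1, 2); (2, 3); (1, 4); (1, 5)].

Definition H1_H2_compls (F : sgraph) : Prop :=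
  [\/ F = H1, F = H2, F = compl H1 | F = compl H2].

Definition stable (G : sgraph) (S : {set G}) : Prop :=
  {in S &, forall x y, ~~ adj x y}.

Definition clique (G : sgraph) (K : {set G}) : Prop :=
  {in K &, forall x y, x != y -> adj x y}.

(* S and K may each be empty. *)
Definition split_partition (G : sgraph) (S K : {set G}) : Prop :=
  [/\ S :|: K = setT, S :&: K = set0, stable S & clique K].

Definition is_module (G : sgraph) (M : {set G}) : Prop :=
  forall v, v \notin M ->
    {in M, forall x, adj v x} \/ {in M, forall x, ~~ adj v x}.

Definition prime_graph (G : sgraph) : Prop :=
  1 < #|G| /\
  forall M : {set G}, is_module M ->
    [\/ M = set0, M = setT | exists x, M = [set x]].

Section RomanTwoDomination.
Variable G : sgraph.
Implicit Types f : {ffun G -> 'I_3}.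

Definition roman2_dominating f : bool :=
  [forall v, (f v == 0 :> nat) ==>
    [exists u, adj v u && (f u == 2 :> nat)] ||
    [exists x, exists y, [&& x != y, adj v x, adj v y,
       f x == 1 :> nat & f y == 1 :> nat]]].

Definition weight f : nat := \sum_v f v.

(* The constant function 2 only serves as a witness that the minimum is over
   a nonempty set. *)
Definition gammaR2 : nat :=
  weight [arg min_(f < [ffun=> ord_max] | roman2_dominating f) weight f].

Lemma gammaR2P :
  (exists2 f, roman2_dominating f & weight f = gammaR2) /\
  (forall f, roman2_dominating f -> gammaR2 <= weight f).
Proof.
rewrite /gammaR2; case: arg_minnP => [|f fP fmin]; last by split=> //; exists f.
by apply/forallP => v; rewrite ffunE.
Qed.
End RomanTwoDomination.

(* Main.v *)
(**
Lower bound: by primality the pendant vertices in [A1] have distinct neighbours,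
so the disjoint pairs {pendant vertex, its neighbour} carry weight at least
[#|A1|]; equality would put 1 on exactly [A1], leaving all other vertices
undominated.

Upper bound: let [k0] in [K] have the most neighbours in [S], and let [D] be the
set of vertices of [S] not adjacent to [k0].  By [H1]-freeness and maximality, a
vertex of [K] has at most one neighbour in [D], so vertices of [D] have disjoint
neighbourhoods; by freeness of the complement of [H1] at most one of them has
degree at least 2.  Hence [#|D| <= #|A1| + 1], and the function equal to 2 at
[k0], 1 on [D] and 0 elsewhere is Roman {2}-dominating. *)

Require Import Defs.
From mathcomp Require Import all_boot.

Set Implicit Arguments.
Unset Strict Implicit.
Unset Printing Implicit Defensive.

(** * Forbidden graphs as adjacency-preserving injections *)

Lemma free_embedding (Hs : sgraph -> Prop) (F G : sgraph) (g : F -> G) :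
  free Hs G -> Hs F -> injective g -> ~ {mono g : x y / adj x y}.
Proof.
move=> freeG HsF g_inj g_adj; apply: (freeG F [set g x | x in F] HsF).
have gP x : g x \in [set g y | y in F] by apply: imset_f.
pose g' x : induced [set g y | y in F] := exist _ (g x) (gP x).
have g'_inj : injective g' by move=> x y /(congr1 val) /g_inj.
have g'_bij : bijective g'.
  apply: inj_card_bij => //.
  by rewrite card_sig (eq_card (B := [set g y | y in F])) ?card_imset.
case: g'_bij => h hK Kh; exists h; split; first by exists g'.
by move=> x y; rewrite -g_adj -{2}(Kh x) -{2}(Kh y).
Qed.

(** Listing the vertices of a would-be copy leaves only the pairs [i < j] to check: symmetry and
    irreflexivity give the rest, and [uniq s] gives injectivity. *)
Lemma free_graph_on_seq (Hs : sgraph -> Prop) (G : sgraph) (n : nat)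
    (e : rel 'I_n) (e_sym : symmetric e) (e_irr : irreflexive e)
    (x0 : G) (s : seq G) :
  free Hs G -> Hs (SGraph e_sym e_irr) -> size s = n -> uniq s ->
  ~ (forall i j : 'I_n, i < j -> adj (nth x0 s i) (nth x0 s j) = e i j).
Proof.
move=> freeG HsF sz_s Us adj_s.
apply: (free_embedding (g := fun i : SGraph e_sym e_irr =>
  nth x0 s (i : 'I_n)) freeG HsF) => i j.
  by move/eqP; rewrite nth_uniq ?sz_s ?ltn_ord // => /eqP /val_inj.
case: (ltngtP (i : 'I_n) (j : 'I_n)) => [||/val_inj->]; first exact: adj_s.
  by move=> ji; rewrite adj_sym adj_s // [LHS]e_sym.
by rewrite !adj_irrefl.
Qed.

(** * Split graphs: forbidden configurations and consequences of primality *)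

Section SplitGraph.
Variables (G : sgraph) (S K : {set G}).
Hypothesis SK : split_partition S K.

Let stabS x y : x \in S -> y \in S -> adj x y = false.
Proof. by case: SK => _ _ st _ xS yS; apply: negbTE; apply: st. Qed.

Let cliqK x y : x \in K -> y \in K -> x != y -> adj x y.
Proof. by case: SK => _ _ _; apply. Qed.

Lemma split_notin_K x : (x \notin K) = (x \in S).
Proof.
case: SK => /setP/(_ x) SUK /setP/(_ x) SIK _ _; move: SUK SIK; rewrite !inE.
by case: (x \in S); case: (x \in K).
Qed.

Lemma split_neq s k : s \in S -> k \in K -> s != k.
Proof. by move=> sS; apply: contraTneq => <-; rewrite split_notin_K. Qed.

Lemma split_adj_K s u : s \in S -> adj s u -> u \in K.
Proof. by move=> sS; apply: contraTT; rewrite split_notin_K => /(stabS sS)->. Qed.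

(** The edge [k k'] with [a], [b] hanging from [k] and [c], [d] from [k'] is an induced [H1]. *)
Lemma free_H1_split k k' a b c d : free H1_H2_compls G ->
  k \in K -> k' \in K -> a != b -> c != d ->
  a \in S -> b \in S -> c \in S -> d \in S ->
  adj k a -> adj k b -> adj k' c -> adj k' d ->
  ~~ adj k' a -> ~~ adj k' b -> ~~ adj k c -> ~~ adj k d -> False.
Proof.
move=> freeG kK k'K ab cd aS bS cS dS ka kb k'c k'd
  /negbTE k'a /negbTE k'b /negbTE kc /negbTE kd.
have kk' : k != k' by apply: contraTneq ka => ->; rewrite k'a.
have ac : a != c by apply: contraTneq ka => ->; rewrite kc.
have ad : a != d by apply: contraTneq ka => ->; rewrite kd.
have bc : b != c by apply: contraTneq kb => ->; rewrite kc.
have bd : b != d by apply: contraTneq kb => ->; rewrite kd.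
apply: (@free_graph_on_seq _ G _ _
  (adj_sym (s := H1)) (adj_irrefl (s := H1)) k [:: a; k; k'; c; b; d] freeG) => //.
- exact: Or41.
- rewrite /= !inE !negb_or ab ac ad kk' cd bd [c == b]eq_sym bc.
  by rewrite !(split_neq aS) // ![_ == b]eq_sym ![_ == c]eq_sym ![_ == d]eq_sym
     !(split_neq bS) // !(split_neq cS) // !(split_neq dS).
case=> [[|[|[|[|[|[|//]]]]]] ?] [[|[|[|[|[|[|//]]]]]] ?] //= _;
  first [exact: stabS | exact: cliqK
        | by rewrite ?ka ?kb ?kc ?kd ?k'a ?k'b ?k'c ?k'd
        | by rewrite adj_sym ?ka ?kb ?kc ?kd ?k'a ?k'b ?k'c ?k'd].
Qed.

(** Dual of [free_H1_split]: among the six vertices the non-edges are [s s'], those from [s] to [c],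
    [d] and those from [s'] to [a], [b], which form a copy of [H1]. *)
Lemma free_compl_H1_split s s' a b c d : free H1_H2_compls G ->
  s \in S -> s' \in S -> a != b -> c != d ->
  adj s a -> adj s b -> adj s' c -> adj s' d ->
  ~~ adj s' a -> ~~ adj s' b -> ~~ adj s c -> ~~ adj s d -> False.
Proof.
move=> freeG sS s'S ab cd sa sb s'c s'd
  /negbTE s'a /negbTE s'b /negbTE sc /negbTE sd.
have aK := split_adj_K sS sa; have bK := split_adj_K sS sb.
have cK := split_adj_K s'S s'c; have dK := split_adj_K s'S s'd.
have ss' : s != s' by apply: contraTneq sa => ->; rewrite s'a.
have ac : a != c by apply: contraTneq sa => ->; rewrite sc.
have ad : a != d by apply: contraTneq sa => ->; rewrite sd.
have bc : b != c by apply: contraTneq sb => ->; rewrite sc.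
have bd : b != d by apply: contraTneq sb => ->; rewrite sd.
apply: (@free_graph_on_seq _ G _ _
  (adj_sym (s := compl H1)) (adj_irrefl (s := compl H1))
  s [:: c; s; s'; a; d; b] freeG) => //.
- exact: Or43.
- rewrite /= !inE !negb_or ss' cd ab !(split_neq sS) // !(split_neq s'S) //.
  rewrite ![_ == s]eq_sym ![_ == s']eq_sym !(split_neq sS) // !(split_neq s'S) //.
  by rewrite ![c == _]eq_sym ac bc ad [d == b]eq_sym bd.
case=> [[|[|[|[|[|[|//]]]]]] ?] [[|[|[|[|[|[|//]]]]]] ?] //= _;
  first [exact: stabS | by rewrite cliqK // eq_sym
        | by rewrite ?sa ?sb ?sc ?sd ?s'a ?s'b ?s'c ?s'd
        | by rewrite adj_sym ?sa ?sb ?sc ?sd ?s'a ?s'b ?s'c ?s'd].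
Qed.

(** Two pendant vertices with the same neighbour [u] would form a module of size two that misses
    [u]. *)
Lemma prime_pendant_inj s s' u : prime_graph G -> s \in S -> s' \in S ->
  deg s = 1 -> deg s' = 1 -> adj s u -> adj s' u -> s = s'.
Proof.
move=> [_ primeG] sS s'S ds ds' su s'u.
have nbr t : deg t = 1 -> adj t u -> forall v, adj v t = (v == u).
  move/eqP/cards1P=> [w /setP Nt] tu v; rewrite adj_sym.
  move: (Nt u) (Nt v); rewrite !inE tu => /esym/eqP-> ->.
  by [].
apply/eqP/negPn/negP => ss'.
have modM : is_module [set s; s'].
  move=> v _; have [vu | vu] := boolP (v == u); [left | right] => x;
    by rewrite !inE => /orP[]/eqP->; rewrite nbr.
have uK := split_adj_K sS su.
case: (primeG _ modM) => [/setP/(_ s)|/setP/(_ u)|[x /(congr1 (fun A => #|pred_of_set A|))]].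
- by rewrite !inE eqxx.
- by rewrite !inE ![u == _]eq_sym !(negbTE (split_neq _ uK)).
- by rewrite cards2 ss' cards1.
Qed.

(** If [v] were isolated, all other vertices together would form a proper module, with at least two
    elements once [2 < #|G|]. *)
Lemma prime_deg_gt0 (v : G) : prime_graph G -> 2 < #|G| -> 0 < deg v.
Proof.
move=> [_ primeG] G_gt2; rewrite lt0n; apply/negP => /eqP/cards0_eq/setP Nv.
have modM : is_module (~: [set v]).
  move=> w; rewrite !inE negbK => /eqP->; right=> x _.
  by move: (Nv x); rewrite !inE => ->.
have := cardsC1 v; case: (primeG _ modM) => [->|/setP/(_ v)|[x ->]].
- by rewrite cards0; case: #|G| G_gt2 => [|[]].
- by rewrite !inE eqxx.
- by rewrite cards1; case: #|G| G_gt2 => [|[|[]]].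
Qed.

(** * Lower bound *)

Lemma roman2_weight_gt_pendants (f : {ffun G -> 'I_3}) : prime_graph G ->
  roman2_dominating f -> #|[set s in S | deg s == 1]| < weight f.
Proof.
move=> primeG /forallP domf; set A1 := [set s in S | _].
have A1P s : s \in A1 -> s \in S /\ deg s = 1 by rewrite inE => /andP[? /eqP].
(* [n s] is the unique neighbour of a pendant [s]; the default [s] is never reached on [A1]. *)
pose n (s : G) := odflt s [pick u | adj s u].
have adj_n s : s \in A1 -> adj s (n s).
  case/A1P=> _ /eqP/cards1P[u /setP/(_ u)]; rewrite !inE eqxx /n => su.
  by case: pickP => [//|/(_ u)]; rewrite su.
have nE s u : s \in A1 -> adj s u -> u = n s.
  move=> sA su; case/A1P: (sA) => _ /eqP/cards1P[w /setP Ns].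
  move: (Ns u) (Ns (n s)); rewrite !inE su adj_n //.
  by move=> /esym/eqP-> /esym/eqP->.
have n_inj : {in A1 &, injective n}.
  move=> s t sA tA nst; case/A1P: (sA) (A1P t tA) => sS ds [tS dt].
  apply: (prime_pendant_inj (u := n s)) => //; first exact: adj_n.
  by rewrite nst adj_n.
have nK s : s \in A1 -> n s \in K.
  by move=> sA; apply: (split_adj_K (proj1 (A1P s sA))); apply: adj_n.
(* If some pendant [s0] has value 0, its only neighbour must have value 2. *)
have [pos_f | ] := boolP [forall s in A1, 0 < f s]; last first.
  rewrite negb_forall => /existsP[s0]; rewrite negb_imply -eqn0Ngt.
  case/andP=> s0A /eqP fs0.
  have f2 s : s \in A1 -> f s == 0 :> nat -> f (n s) = 2 :> nat.
    move=> sA fs; have /implyP/(_ fs)/orP[] := domf s.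
      by case/existsP=> u /andP[/(nE _ _ sA)-> /eqP].
    case/existsP=> x /existsP[y /and5P[xy /(nE _ _ sA) xn /(nE _ _ sA) yn]].
    by rewrite xn yn eqxx in xy.
  (* Since [A1] lies in [S] and [n @: A1] in [K], splitting the sum this way counts no vertex
     twice. *)
  have -> : weight f = \sum_(v in S) f v + \sum_(v in K) f v.
    rewrite /weight (bigID (mem S)) /=; congr (_ + _); apply: eq_bigl => v.
    by rewrite -split_notin_K negbK.
  have nA_sub : n @: A1 \subset K by apply/subsetP=> _ /imsetP[s sA ->]; apply: nK.
  have A_sub : A1 \subset S by apply/subsetP=> s /A1P[].
  have sub_sum (A B : {set G}) : A \subset B ->
      \sum_(v in A) f v <= \sum_(v in B) f v.
    move=> AB; rewrite [leqRHS](big_setID A) /= (setIidPr AB).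
    exact: leq_addr.
  apply: leq_trans (leq_add (sub_sum _ _ A_sub) (sub_sum _ _ nA_sub)).
  (* Each pair [s], [n s] carries at least 1 and the pair of [s0] carries 2; this surplus makes the
     inequality strict. *)
  rewrite big_imset //= -big_split /= (bigD1 s0) //= fs0 f2 ?fs0 //.
  rewrite (cardD1 s0) s0A ltn_add2l -sum1_card ltnS.
  rewrite (eq_bigl (fun i => (i \in A1) && (i != s0))); last first.
    by move=> i; rewrite !inE andbC.
  apply: leq_sum => s /andP[sA _].
  by case: (posnP (f s)) => [/eqP/(f2 _ sA)->|]; [rewrite addn2 | case: (nat_of_ord (f s))].
have {}pos_f s : s \in A1 -> 0 < f s by move/forall_inP: pos_f; apply.
have leA : #|A1| <= \sum_(v in A1) f v.
  by rewrite -sum1_card; apply: leq_sum.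
have weightE : weight f = \sum_(v in A1) f v + \sum_(v | v \notin A1) f v.
  by rewrite /weight (bigID (mem A1)).
(* [A1] already carries [#|A1|], so one positive value outside it suffices. It remains to see how a
   vertex [v0] outside [A1] with value 0 is dominated. *)
have out v : v \notin A1 -> 0 < f v -> #|A1| < weight f.
  move=> vA fv; rewrite weightE (bigD1 v vA) /= addnCA.
  by rewrite -add1n leq_add // (leq_trans leA) ?leq_addr.
have [v0 v0A] : exists v, v \notin A1.
  have [A0 | [s sA]] := set_0Vmem A1; last first.
    by exists (n s); apply: contraL (nK s sA) => /A1P[]; rewrite split_notin_K.
  have /card_gt0P[v _] : 0 < #|G| by apply: leq_trans (proj1 primeG).
  by exists v; rewrite A0 inE.
have [f0 | ] := posnP (f v0); last exact: out v0A.
move/eqP in f0; have /implyP/(_ f0)/orP[] := domf v0.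
  case/existsP=> u /andP[_ /eqP fu].
  have [uA|uA] := boolP (u \in A1); last by apply: (out u); rewrite ?fu.
  (* A pendant of value 2 exceeds by one the unit counted for it. *)
  rewrite weightE (bigD1 u) //= fu (cardD1 u) uA -sum1_card -addnA.
  rewrite -[leqLHS]/(2 + _) leq_add2l (leq_trans _ (leq_addr _ _)) //.
  rewrite (eq_bigl (fun i => (i \in A1) && (i != u))); last first.
    by move=> i; rewrite !inE andbC.
  by apply: leq_sum => s /andP[/pos_f].
case/existsP=> x /existsP[y /and5P[xy v0x v0y /eqP fx /eqP fy]].
have [xA|xA] := boolP (x \in A1); last by apply: (out x); rewrite ?fx.
have [yA|yA] := boolP (y \in A1); last by apply: (out y); rewrite ?fy.
(* Here [v0] would be the neighbour of two distinct pendants. *)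
rewrite adj_sym in v0x; rewrite adj_sym in v0y; case/eqP: xy.
by apply: n_inj => //; rewrite -(nE x v0) // -(nE y v0).
Qed.

(** * Upper bound *)

Lemma gammaR2_le_center k0 : k0 \in K ->
  gammaR2 G <= 2 + #|[set s in S | ~~ adj k0 s]|.
Proof.
move=> k0K; set D := [set s in S | _].
pose f : {ffun G -> 'I_3} :=
  [ffun v => if v == k0 then inord 2 else inord (v \in D)].
have fE v : f v = (if v == k0 then 2 else v \in D) :> nat.
  by rewrite ffunE; case: eqP => _; rewrite inordK //; case: (_ \in _).
have k0D : k0 \notin D by rewrite inE -split_notin_K k0K.
have -> : 2 + #|D| = weight f.
  rewrite /weight (bigD1 k0) //= fE eqxx; congr (_ + _).
  rewrite -sum1_card big_mkcond [in LHS](bigD1 k0) //= (negbTE k0D).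
  by apply: eq_bigr => v /negbTE vk0; rewrite fE vk0; case: (v \in D).
apply: (proj2 (gammaR2P G)); apply/forallP => v; apply/implyP; rewrite fE.
have [//|vk0] := eqVneq v k0; rewrite eqb0 => vD.
(* A vertex of value 0 lies in [K], or in [S] and is adjacent to [k0]; either way [k0] dominates
   it. *)
apply/orP; left; apply/existsP; exists k0; rewrite fE !eqxx andbT.
move: vD; rewrite inE negb_and negbK -split_notin_K negbK.
by case/orP=> [vK | ]; [apply: cliqK | rewrite adj_sym].
Qed.

(* Two isolated vertices form a prime graph, possibly with [K] empty; graphs on
   at most two vertices are therefore treated apart. *)
Lemma gammaR2_le_pendants : prime_graph G -> free H1_H2_compls G ->
  gammaR2 G <= #|[set s in S | deg s == 1]| + 3.
Proof.
move=> primeG freeG; have [G_le2 | G_gt2] := leqP #|G| 2.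
  (* The constant function 1 has no vertex of value 0, and its weight is at most 2. *)
  apply: leq_trans (_ : weight [ffun _ : G => inord 1 : 'I_3] <= _).
    apply: (proj2 (gammaR2P G)); apply/forallP => v.
    by rewrite ffunE inordK.
  rewrite /weight (eq_bigr (fun=> 1)) => [|v _]; last by rewrite ffunE inordK.
  by rewrite sum1_card (leq_trans G_le2) // addnC.
pose NS (k : G) := [set s in S | adj k s].
have [k1 k1K] : exists k, k \in K.
  have /card_gt0P[v _] : 0 < #|G| by apply: leq_trans G_gt2.
  have [vK|] := boolP (v \in K); first by exists v.
  rewrite split_notin_K => vS.
  have /card_gt0P[u] := prime_deg_gt0 v primeG G_gt2.
  by rewrite inE => /(split_adj_K vS); exists u.
have [k0 k0K k0max] := @arg_maxnP _ k1 (mem K) (fun k => #|NS k|) k1K.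
apply: leq_trans (gammaR2_le_center k0K) _.
set D := [set s in S | _]; set A1 := [set s in S | deg s == 1].
(* Of the 3, two units pay for [k0] and one for a possible vertex of [D] outside [A1]. *)
rewrite addnC -[3]/(1 + 2) addnA leq_add2r.
have DP s : s \in D -> s \in S /\ ~~ adj k0 s by rewrite inE => /andP[].
have disj k s s' : s \in D -> s' \in D -> adj s k -> adj s' k -> s = s'.
  move=> sD s'D sk s'k; apply/eqP/negPn/negP => ss'.
  case/DP: sD (DP _ s'D) => sS k0s [s'S k0s'].
  have kK := split_adj_K sS sk.
  (* [s] and [s'] are neighbours of [k] but not of [k0]; by maximality [k0] then has two neighbours
     in [S] that [k] misses, which produces [H1]. *)
  have : 2 <= #|NS k :\: NS k0|.
    rewrite -[2]/(true.+1) -ss' -cards2; apply/subset_leq_card/subsetP => x.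
    by rewrite !inE => /orP[]/eqP->; rewrite ?sS ?s'S /= ![adj k _]adj_sym
      ?sk ?s'k andbT.
  have NSle : #|NS k :\: NS k0| <= #|NS k0 :\: NS k|.
    rewrite !cardsD [NS k0 :&: _]setIC leq_sub2r //; exact: k0max.
  move/leq_trans/(_ NSle)/card_gt1P=> [a [b [+ + ab]]].
  rewrite !inE !negb_and => /and3P[ka aS k0a] /and3P[kb bS k0b].
  rewrite aS /= in ka; rewrite bS /= in kb.
  by apply: (free_H1_split (k := k0) (k' := k) (a := a) (b := b)
    (c := s) (d := s')) => //; rewrite adj_sym.
(* By [disj], distinct [s] and [s'] share no neighbour, so two neighbours of each yield the
   complement of [H1]. *)
have degD s s' : s \in D -> s' \in D -> 1 < deg s -> 1 < deg s' -> s = s'.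
  move=> sD s'D /card_gt1P[a [b [+ + ab]]] /card_gt1P[c [d [+ + cd]]].
  rewrite !inE => sa sb s'c s'd; apply/eqP/negPn/negP => /eqP ss'.
  case: (DP _ sD) (DP _ s'D) => sS _ [s'S _].
  apply: (free_compl_H1_split freeG sS s'S ab cd sa sb s'c s'd).
  - by apply/negP => /(disj _ _ _ sD s'D sa).
  - by apply/negP => /(disj _ _ _ sD s'D sb).
  - by apply/negP => /disj/(_ s'c); apply: (ss' \o _) => ->.
  - by apply/negP => /disj/(_ s'd); apply: (ss' \o _) => ->.
rewrite -(cardsID A1 D) leq_add ?subset_leq_card ?subsetIr //.
rewrite leqNgt; apply/negP => /card_gt1P[s [s' [+ + ss']]].
(* Degree 0 is excluded by primality, so not being pendant means degree at least 2. *)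
have big t : t \in D :\: A1 -> t \in D /\ 1 < deg t.
  case/setDP=> tD; rewrite inE (proj1 (DP t tD)) /= => dt; split=> //.
  by rewrite ltn_neqAle eq_sym dt prime_deg_gt0.
by move=> /big[sD ds] /big[s'D ds']; rewrite (degD s s') ?eqxx in ss'.
Qed.

End SplitGraph.

Theorem theorem3p18 (G : sgraph) (S K : {set G}) :
  split_partition S K ->
  prime_graph G ->
  free H1_H2_compls G ->
  let A1 := [set s in S | deg s == 1] in
  #|A1| + 1 <= gammaR2 G <= #|A1| + 3.
Proof.
move=> SK primeG freeG /=; rewrite (gammaR2_le_pendants SK) // andbT addn1.
have [[f domf <-] _] := gammaR2P G.
exact: (roman2_weight_gt_pendants SK).
Qed.
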